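(* Let $M\ge 1$ and $p\in[0,1]$. For each qubit $m\in\{1,\dots,M\}$, the twirled dephasing channel equals the single-qubit depolarizing channel with the same parameter $p$: for every operator $\rho$ on $(\mathbb{C}^2)^{\otimes M}$, $$\frac13\sum_{U\in\{I,H,HS\}}U^\dagger\,\mathcal{E}^{(z)}_m\big(U\rho U^\dagger\big)\,U=(1-p)\rho+\frac p3\left(X_m\rho X_m+Y_m\rho Y_m+Z_m\rho Z_m\right),$$ where $I,H,S$ act on qubit $m$. Consequently the composition over $m=1,\dots,M$ of the twirled dephasing channels is the $M$-qubit local depolarizing channel with parameter $p$, and for this fully twirled channel the PQES error threshold for the target $|\psi_0\rangle=|+\rangle^{\otimes M}$ is $p_{\mathrm{th}}=3/4$.
   Context: $X_m,Y_m,Z_m$ are the Pauli operators acting on qubit $m$ and as the identity elsewhere; $H$ is the Hadamard operator, $S=\mathrm{diag}(1,i)$, and $|+\rangle=(|0\rangle+|1\rangle)/\sqrt2$. The dephasing channel on qubit $m$ is $\mathcal{E}^{(z)}_m(\rho)=(1-p)\rho+p\,Z_m\rho Z_m$. The $M$-qubit local depolarizing channel with parameter $p$ is the composition over $m=1,\dots,M$ of the maps $\rho\mapsto(1-p)\rho+\frac p3(X_m\rho X_m+Y_m\rho Y_m+Z_m\rho Z_m)$. Purification map: for an integer $\ell\ge0$ and a density matrix $\rho$, $\mathcal{P}_\ell(\rho)=\rho^{N}/\mathrm{Tr}(\rho^{N})$ with $N=2^\ell$. Effective logical error rate for an error channel $\mathcal{E}$ (depending on $p$): one cycle applies $\mathcal{E}$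 and then $\mathcal{P}_\ell$. With $F(t)$ the fidelity $\langle\psi_0|\rho|\psi_0\rangle$ after $t$ cycles starting from $|\psi_0\rangle\langle\psi_0|$, $$\gamma_L(\ell,p)=F(0)-F(1)=1-\langle\psi_0|\,\mathcal{P}_\ell\big(\mathcal{E}(|\psi_0\rangle\langle\psi_0|)\big)|\psi_0\rangle .$$ PQES (purification quantum error suppression) error threshold: $p_{\mathrm{th}}$ is the largest value in $[0,1]$ such that $\lim_{\ell\to\infty}\gamma_L(\ell,p)=0$ for every $p\in[0,1]$ with $p<p_{\mathrm{th}}$. *)

(* Defs.v *)
From mathcomp Require Import all_boot all_order all_algebra.
From mathcomp Require Import complex.
From mathcomp Require Import boolp classical_sets reals topology normedtype.

Set Implicit Arguments.
Unset Strict Implicit.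
Unset Printing Implicit Defensive.

Import Order.TTheory GRing.Theory Num.Theory numFieldNormedType.Exports.

Local Open Scope classical_set_scope.
Local Open Scope ring_scope.
Local Open Scope complex_scope.
Local Open Scope sesquilinear_scope.

(* Dimension of (C^2)^{(x) M}: the computational basis is indexed by bit
   strings b : {ffun 'I_M -> 'I_2}, listed by [enum_val]; the qubits 1, ..., M
   are numbered 0, ..., M - 1. *)
Notation qdim M := #|{ffun 'I_M -> 'I_2}|.

Section Qubits.
Variable R : realType.
Local Notation C := R[i].

Definition mx2 (a b c d : C) : 'M[C]_2 :=
  \matrix_(i < 2, j < 2) nth 0 (nth [::] [:: [:: a; b]; [:: c; d]] i) j.

Definition pauliX := mx2 0 1 1 0.
Definition pauliY := mx2 0 (- 'i) 'i 0.
Definition pauliZ := mx2 1 0 0 (-1).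
Definition hadamard := (sqrtC 2)^-1 *: mx2 1 1 1 (-1).
Definition phaseS := mx2 1 0 0 'i.

Definition ket_plus : 'cV[C]_2 := (sqrtC 2)^-1 *: const_mx 1.

Section Register.
Variable M : nat.
Local Notation op := 'M[C]_(qdim M).
Local Notation ket := 'cV[C]_(qdim M).

Definition bits (a : 'I_(qdim M)) : {ffun 'I_M -> 'I_2} := enum_val a.

(* A_0 (x) ... (x) A_(M-1), by its matrix elements
   <a| A |b> = \prod_k <a_k| A_k |b_k> in the computational basis. *)
Definition tens_op (A : 'I_M -> 'M[C]_2) : op :=
  \matrix_(a, b) \prod_(k < M) A k (bits a k) (bits b k).

Definition tens_ket (v : 'I_M -> 'cV[C]_2) : ket :=
  \col_a \prod_(k < M) v k (bits a k) 0.

Definition on_qubit (m : 'I_M) (A : 'M[C]_2) : op :=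
  tens_op (fun k => if k == m then A else 1%:M).

Definition plus_state : ket := tens_ket (fun=> ket_plus).

Definition dephasing (p : R) (m : 'I_M) (rho : op) : op :=
  let Z := on_qubit m pauliZ in
  (1 - p)%:C *: rho + p%:C *: (Z *m rho *m Z).

Definition depolarizing (p : R) (m : 'I_M) (rho : op) : op :=
  let X := on_qubit m pauliX in
  let Y := on_qubit m pauliY in
  let Z := on_qubit m pauliZ in
  (1 - p)%:C *: rho
  + (p / 3)%:C *: (X *m rho *m X + Y *m rho *m Y + Z *m rho *m Z).

Definition twirl_gates (m : 'I_M) : seq op :=
  [:: 1%:M; on_qubit m hadamard; on_qubit m hadamard *m on_qubit m phaseS].

Definition twirled_dephasing (p : R) (m : 'I_M) (rho : op) : op :=
  3^-1 *: \sum_(U <- twirl_gates m)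
            U^t* *m dephasing p m (U *m rho *m U^t*) *m U.

(* The composition E_(M-1) \o ... \o E_0, with E_0 applied first. *)
Definition compose_qubits (E : 'I_M -> op -> op) (rho : op) : op :=
  foldl (fun sigma m => E m sigma) rho (enum 'I_M).

Definition local_depolarizing (p : R) : op -> op :=
  compose_qubits (depolarizing p).

Definition fully_twirled_dephasing (p : R) : op -> op :=
  compose_qubits (twirled_dephasing p).

Definition purify (l : nat) (rho : op) : op :=
  let N := (2 ^ l)%N in (\tr (rho ^+ N))^-1 *: rho ^+ N.

Definition fidelity (psi : ket) (rho : op) : C := (psi^t* *m rho *m psi) 0 0.

(* Fidelity F(t) with the initial state after t cycles. *)
Definition fidelity_after (E : op -> op) (psi : ket) (l t : nat) : C :=
  fidelity psi (iter t (fun rho => purify l (E rho)) (psi *m psi^t*)).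

Definition gammaL (E : R -> op -> op) (psi : ket) (l : nat) (p : R) : C :=
  fidelity_after (E p) psi l 0 - fidelity_after (E p) psi l 1.

(* [C^o] is C itself, carrying the topology of its norm; gammaL is kept
   complex-valued, although it is real for Hermitian-preserving E. *)
Definition suppressed_below (E : R -> op -> op) (psi : ket) : set R :=
  [set t | 0 <= t <= 1 /\
     forall p : R, 0 <= p <= 1 -> p < t ->
       gammaL E psi l p @[l --> \oo] --> (0 : C^o)].

Definition is_pqes_threshold (E : R -> op -> op) (psi : ket) (t : R) : Prop :=
  suppressed_below E psi t /\ ubound (suppressed_below E psi) t.

End Register.
End Qubits.

Arguments plus_state {R} M.
Arguments fully_twirled_dephasing {R} M p rho.
Arguments local_depolarizing {R} M p rho.

(* Main.v *)
Require Import Defs.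
From mathcomp Require Import all_boot all_order all_algebra.
From mathcomp Require Import complex.
From mathcomp Require Import boolp classical_sets reals topology normedtype.
From mathcomp Require Import sequences realfun ring lra.
Import Order.TTheory GRing.Theory Num.Theory.
Import numFieldNormedType.Exports.
Local Open Scope ring_scope.
Local Open Scope complex_scope.
Local Open Scope sesquilinear_scope.

Set Implicit Arguments.
Unset Strict Implicit.
Unset Printing Implicit Defensive.

(** Conjugating Z by I, H and HS gives Z, X and -Y, and the sign cancels in
    (-Y) rho (-Y), so averaging the conjugated dephasing channels yields the
    depolarizing channel.  On |+><+|^{(x) M} the local depolarizing channel
    acts qubit by qubit and produces the product of the states
    (1 - r) |+><+| + r |-><-| with r = 2 p / 3.  Powers, traces and fidelities
    factor over the qubits, so the purified state has fidelity
    (1 + (r / (1 - r))^N)^{-M} with N = 2^l.  This tends to 1 when r < 1/2,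
    i.e. p < 3/4, and equals 2^{-M} for every l when p = 3/4. *)

(** * Product operators and product vectors on the register *)

Section Tensor.
Variables (R : realType) (M : nat).
Implicit Types (A B : 'I_M -> 'M[R[i]]_2) (v w : 'I_M -> 'cV[R[i]]_2).
Implicit Types (m : 'I_M) (U V : 'M[R[i]]_2).

(** Distributivity of products over sums, once basis indices are traded for bit strings through
    [enum_val]. Products, traces and inner products of tensors all factor over the qubits by this
    identity. *)
Lemma sum_prod_bits (F : 'I_M -> 'I_2 -> R[i]) :
  \sum_a \prod_(k < M) F k (bits a k) = \prod_(k < M) \sum_j F k j.
Proof.
apply: etrans (esym (bigA_distr_bigA F)).
rewrite [RHS](reindex_onto (@enum_val _ _) enum_rank) /=; last first.
  by move=> f _; rewrite enum_rankK.
by apply: eq_big => [a|a _]; rewrite ?enum_valK ?eqxx.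
Qed.

Lemma eq_tens_op A B : A =1 B -> tens_op A = tens_op B.
Proof.
move=> eqAB; apply/matrixP => a b; rewrite !mxE.
by apply: eq_bigr => k _; rewrite eqAB.
Qed.

Lemma tens_opM A B : tens_op A *m tens_op B = tens_op (fun k => A k *m B k).
Proof.
apply/matrixP => a b; rewrite !mxE.
under eq_bigr do rewrite !mxE -big_split /=.
rewrite (sum_prod_bits (fun k j => A k (bits a k) j * B k j (bits b k))).
by apply: eq_bigr => k _; rewrite mxE.
Qed.

Lemma tens_op1 : tens_op (fun _ : 'I_M => 1%:M) = 1%:M :> 'M[R[i]]_(qdim M).
Proof.
apply/matrixP => a b; rewrite !mxE; have [<-|neq_ab] := eqVneq a b.
  by rewrite big1 // => k _; rewrite mxE eqxx.
(* Distinct indices list distinct bit strings; one differing bit makes a factor of the product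
   vanish. *)
have [eq_bits|] := altP (@forallP _ (fun k => bits a k == bits b k)).
  case/eqP: neq_ab; apply: enum_val_inj; apply/ffunP => k.
  exact/eqP/eq_bits.
rewrite negb_forall => /existsP[k neq_k].
by rewrite (bigD1 k) //= mxE (negPf neq_k) mul0r.
Qed.

Lemma tens_opX A n : tens_op A ^+ n = tens_op (fun k => A k ^+ n).
Proof.
elim: n => [|n IHn]; first exact/esym/tens_op1.
rewrite exprS IHn; apply: etrans (tens_opM _ _) _.
by apply: eq_tens_op => k; rewrite exprS.
Qed.

Lemma tens_op_adj A : (tens_op A)^t* = tens_op (fun k => (A k)^t*).
Proof.
apply/matrixP => a b; rewrite !mxE rmorph_prod.
by apply: eq_bigr => k _; rewrite !mxE.
Qed.

Lemma mxtrace_tens_op A : \tr (tens_op A) = \prod_(k < M) \tr (A k).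
Proof.
rewrite /mxtrace -(sum_prod_bits (fun k j => A k j j)).
by apply: eq_bigr => a _; rewrite mxE.
Qed.

Lemma tens_op_ket A v :
  tens_op A *m tens_ket v = tens_ket (fun k => A k *m v k).
Proof.
apply/matrixP => a b; rewrite !mxE.
under eq_bigr do rewrite !mxE -big_split /=.
rewrite (sum_prod_bits (fun k j => A k (bits a k) j * v k j 0)).
by apply: eq_bigr => k _; rewrite mxE.
Qed.

Lemma tens_ket_inner v w :
  ((tens_ket v)^t* *m tens_ket w) 0 0 = \prod_(k < M) ((v k)^t* *m w k) 0 0.
Proof.
rewrite !mxE.
under eq_bigr do rewrite !mxE rmorph_prod -big_split /=.
rewrite (sum_prod_bits (fun k j => (v k j 0)^* * w k j 0)%R).
by apply: eq_bigr => k _; rewrite mxE; apply: eq_bigr => j _; rewrite !mxE.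
Qed.

Lemma tens_ket_outer v w :
  tens_ket v *m (tens_ket w)^t* = tens_op (fun k => v k *m (w k)^t*).
Proof.
apply/matrixP => a b; rewrite !mxE big_ord1 !mxE rmorph_prod -big_split /=.
by apply: eq_bigr => k _; rewrite !mxE big_ord1 !mxE.
Qed.

Lemma fidelity_tens v A :
  fidelity (tens_ket v) (tens_op A)
  = \prod_(k < M) ((v k)^t* *m A k *m v k) 0 0.
Proof.
rewrite /fidelity -mulmxA tens_op_ket tens_ket_inner.
by apply: eq_bigr => k _; rewrite mulmxA.
Qed.

Lemma fidelityZ (psi : 'cV[R[i]]_(qdim M)) (c : R[i]) rho :
  fidelity psi (c *: rho) = c * fidelity psi rho.
Proof. by rewrite /fidelity -scalemxAr -scalemxAl mxE. Qed.

(** Isolates one tensor slot, so that linearity in that slot can be stated; [on_qubit m U] is the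
    instance whose other factors are identities. *)
Definition with_factor m U A k := if k == m then U else A k.

Lemma with_factor_id m A : with_factor m (A m) A =1 A.
Proof. by move=> k; rewrite /with_factor; case: eqP => // ->. Qed.

Lemma tens_op_factorE m U A a b :
  tens_op (with_factor m U A) a b
  = U (bits a m) (bits b m) * \prod_(k < M | k != m) A k (bits a k) (bits b k).
Proof.
rewrite mxE (bigD1 m) //= /with_factor eqxx; congr (_ * _).
by apply: eq_bigr => k /negPf->.
Qed.

Lemma tens_op_factorD m U V A :
  tens_op (with_factor m (U + V) A)
  = tens_op (with_factor m U A) + tens_op (with_factor m V A).
Proof.
by apply/matrixP => a b; rewrite [RHS]mxE !tens_op_factorE mxE mulrDl.
Qed.

Lemma tens_op_factorZ m c U A :
  tens_op (with_factor m (c *: U) A) = c *: tens_op (with_factor m U A).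
Proof.
by apply/matrixP => a b; rewrite [RHS]mxE !tens_op_factorE mxE mulrA.
Qed.

Lemma on_qubit1 m : on_qubit m (1%:M : 'M[R[i]]_2) = 1%:M.
Proof. by rewrite -tens_op1; apply: eq_tens_op => k; case: ifP. Qed.

Lemma on_qubitM m U V : on_qubit m U *m on_qubit m V = on_qubit m (U *m V).
Proof.
by rewrite tens_opM; apply: eq_tens_op => k; case: ifP; rewrite ?mulmx1.
Qed.

Lemma on_qubitN m U : on_qubit m (- U) = - on_qubit m U.
Proof.
by rewrite -scaleN1r -[RHS]scaleN1r; apply: tens_op_factorZ.
Qed.

Lemma on_qubit_adj m U : (on_qubit m U)^t* = on_qubit m (U^t*).
Proof.
rewrite tens_op_adj; apply: eq_tens_op => k; case: ifP => // _.
by rewrite trmx1 map_mx1.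
Qed.

Lemma on_qubit_sandwich m U V A :
  on_qubit m U *m tens_op A *m on_qubit m V
  = tens_op (with_factor m (U *m A m *m V) A).
Proof.
rewrite !tens_opM; apply: eq_tens_op => k; rewrite /with_factor.
by case: eqP => [->|]; rewrite ?mulmx1 ?mul1mx.
Qed.

End Tensor.

(** * Single-qubit gates and operators diagonal in the |+>, |-> basis *)

Section Qubit.
Variable R : realType.
Local Notation C := R[i].

Local Notation iC := (Complex 0 1 : C).

(* The entry [- 'i] of [pauliY] was parsed in [ring_scope], as the opposite of
   [Num.imaginary], whereas its other entry is the [Complex 0 1] of
   [complex_scope]. *)
Lemma imaginaryE : Num.imaginary = iC.
Proof. by []. Qed.

Lemma mul_ii : iC * iC = -1.
Proof. by rewrite -expr2 sqr_i. Qed.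

Lemma conjC_i : Num.conj iC = - iC.
Proof.
have i0 : iC != 0.
  by rewrite eq_complex /= oner_eq0 andbF.
(* Multiplied by i, the claim becomes |i|^2 = 1. *)
apply: (mulIf i0); rewrite mulNr mul_ii opprK -normCKC normc_def /=.
by rewrite expr0n expr1n add0r sqrtr1 expr1n.
Qed.

Lemma mx2M (a b c d a' b' c' d' : C) :
  mx2 a b c d *m mx2 a' b' c' d'
  = mx2 (a * a' + b * c') (a * b' + b * d') (c * a' + d * c') (c * b' + d * d').
Proof.
by apply/matrixP => -[[|[|//]] ?] [[|[|//]] ?];
   rewrite !mxE !big_ord_recl big_ord0 !mxE /= addr0.
Qed.

Lemma mx2D (a b c d a' b' c' d' : C) :
  mx2 a b c d + mx2 a' b' c' d' = mx2 (a + a') (b + b') (c + c') (d + d').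
Proof.
by apply/matrixP => -[[|[|//]] ?] [[|[|//]] ?]; rewrite !mxE.
Qed.

Lemma mx2Z (x a b c d : C) :
  x *: mx2 a b c d = mx2 (x * a) (x * b) (x * c) (x * d).
Proof.
by apply/matrixP => -[[|[|//]] ?] [[|[|//]] ?]; rewrite !mxE.
Qed.

Lemma mx2_adj (a b c d : C) :
  (mx2 a b c d)^t* = mx2 (Num.conj a) (Num.conj c) (Num.conj b) (Num.conj d).
Proof.
by apply/matrixP => -[[|[|//]] ?] [[|[|//]] ?]; rewrite !mxE.
Qed.

Lemma mx2_1 : 1%:M = mx2 1 0 0 1 :> 'M[C]_2.
Proof.
by apply/matrixP => -[[|[|//]] ?] [[|[|//]] ?]; rewrite !mxE.
Qed.

Lemma mxtrace_mx2 (a b c d : C) : \tr (mx2 a b c d) = a + d.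
Proof.
by rewrite /mxtrace !big_ord_recl big_ord0 !mxE /= addr0.
Qed.

Let s2 : C := (sqrtC 2)^-1.

Lemma invsqrtC2_sqr : s2 * s2 = 2^-1.
Proof. by rewrite /s2 -invfM -expr2 sqrtCK. Qed.

Lemma conj_invsqrtC2 : Num.conj s2 = s2.
Proof. by apply: geC0_conj; rewrite invr_ge0 sqrtC_ge0 ler0n. Qed.

Lemma hadamardE : hadamard R = mx2 s2 s2 s2 (- s2).
Proof. by rewrite /hadamard mx2Z !mulr1 mulrN1. Qed.

Lemma hadamard_unitary : (hadamard R)^t* *m hadamard R = 1%:M.
Proof.
rewrite hadamardE mx2_adj rmorphN /= conj_invsqrtC2 mx2M.
rewrite !(mulrN, mulNr, opprK) invsqrtC2_sqr subrr mx2_1.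
by rewrite -mulr2n -[2^-1]mulr1 -mulrnAr mulVf // pnatr_eq0.
Qed.

Lemma phaseS_unitary : (phaseS R)^t* *m phaseS R = 1%:M.
Proof.
rewrite mx2_adj conjC1 conjC0 conjC_i mx2M mx2_1.
by rewrite !(mulr0, mul0r, mulr1, mul1r, addr0, add0r) mulNr mul_ii opprK.
Qed.

Lemma hadamard_pauliZ :
  (hadamard R)^t* *m pauliZ R *m hadamard R = pauliX R.
Proof.
rewrite hadamardE mx2_adj rmorphN /= conj_invsqrtC2 !mx2M.
rewrite !(mulr0, mul0r, mulr1, mul1r, addr0, add0r, mulrN, mulNr, opprK).
rewrite invsqrtC2_sqr subrr.
by rewrite -mulr2n -[2^-1]mulr1 -mulrnAr mulVf // pnatr_eq0.
Qed.

Lemma phaseS_pauliX : (phaseS R)^t* *m pauliX R *m phaseS R = - pauliY R.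
Proof.
rewrite -scaleN1r mx2Z mx2_adj conjC1 conjC0 conjC_i !mx2M.
by rewrite !(mulr0, mul0r, mulr1, mul1r, addr0, add0r, mulN1r, mulNr, opprK).
Qed.

(* The operator with eigenvalue [x] on |+> and [y] on |->. *)
Definition plus_minus_diag (x y : C) : 'M[C]_2 :=
  mx2 ((x + y) / 2) ((x - y) / 2) ((x - y) / 2) ((x + y) / 2).

Lemma plus_minus_diagX (x y : C) n :
  plus_minus_diag x y ^+ n = plus_minus_diag (x ^+ n) (y ^+ n).
Proof.
elim: n => [|n IHn].
  rewrite !expr0 -[LHS]/(1%:M) mx2_1 /plus_minus_diag subrr mul0r.
  by rewrite -mulr2n mulfV // pnatr_eq0.
by rewrite exprS IHn -[LHS]/(_ *m _) mx2M !exprS; congr mx2; field.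
Qed.

Lemma mxtrace_plus_minus_diag (x y : C) :
  \tr (plus_minus_diag x y) = x + y.
Proof. by rewrite mxtrace_mx2; field. Qed.

Lemma ket_plus_outer : ket_plus R *m (ket_plus R)^t* = plus_minus_diag 1 0.
Proof.
apply/matrixP => i j; rewrite mxE big_ord1 !mxE mulr1 conj_invsqrtC2.
rewrite -/s2 invsqrtC2_sqr.
by case: i j => [[|[|//]] ?] [[|[|//]] ?]; rewrite /= ?(addr0, subr0) mul1r.
Qed.

Lemma ket_plus_expectation (x y : C) :
  ((ket_plus R)^t* *m plus_minus_diag x y *m ket_plus R) 0 0 = x.
Proof.
rewrite mxE !big_ord_recl big_ord0 !mxE !big_ord_recl !big_ord0 !mxE /=.
rewrite !mulr1 conj_invsqrtC2 -/s2 !addr0.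
(* The four matrix entries sum to 2x; the two normalizations are grouped so that their product can
   be replaced by 1/2. *)
transitivity (s2 * s2 * (2 * x)); first by field.
by rewrite invsqrtC2_sqr; field.
Qed.

Definition depolarize1 (p : R) (A : 'M[C]_2) : 'M[C]_2 :=
  (1 - p)%:C *: A
  + (p / 3)%:C *: (pauliX R *m A *m pauliX R + pauliY R *m A *m pauliY R
                   + pauliZ R *m A *m pauliZ R).

(** Conjugation by X fixes both |+><+| and |-><-|, while Y and Z each exchange them: the eigenvalues
    are swapped with weight 2p/3. *)
Lemma depolarize_plus_minus_diag (p : R) (x y : C) :
  depolarize1 p (plus_minus_diag x y)
  = plus_minus_diag ((1 - 2 * p / 3)%:C * x + (2 * p / 3)%:C * y)
                    ((2 * p / 3)%:C * x + (1 - 2 * p / 3)%:C * y).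
Proof.
rewrite /depolarize1 /pauliY imaginaryE !mx2M !mx2D !mx2Z mx2D.
rewrite !(mulr0, mul0r, mulr1, mul1r, addr0, add0r, mulrN, mulNr, opprK).
(* Entries of Y A Y have this shape; i must be eliminated before [field], to which it is an atom. *)
have mul_izi (z : C) : iC * z * iC = - z by rewrite mulrAC mul_ii mulN1r.
rewrite !mul_izi opprK !(rmorphB, rmorphM, rmorph1, fmorphV, rmorph_nat) /=.
by congr mx2; field.
Qed.

End Qubit.

(** * Twirling the dephasing channel *)

(** The outer V and U cancel against the inner ones in the first term, and regroup around each Z in
    the second. One computation serves all three gates. *)
Lemma conj_channel (K : comNzRingType) n (U V Z rho : 'M[K]_n) (a b : K) :
  V *m U = 1%:M ->
  V *m (a *: (U *m rho *m V) + b *: (Z *m (U *m rho *m V) *m Z)) *m U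
  = a *: rho + b *: (V *m Z *m U *m rho *m (V *m Z *m U)).
Proof.
move=> VU; rewrite mulmxDr mulmxDl -!scalemxAr -!scalemxAl !mulmxA.
by rewrite VU mul1mx -[rho *m V *m U]mulmxA VU mulmx1.
Qed.

(* The gates I, H, HS yield Z, X, -Y in this order, while [depolarizing] lists
   X, Y, Z: hence [z] comes with the first term. *)
Lemma average_sum3 (K : fieldType) (V : lmodType K) (T : Type) (F : T -> V)
    (t1 t2 t3 : T) (a b : K) (u x y z : V) :
  3 != 0 :> K ->
  F t1 = a *: u + b *: z -> F t2 = a *: u + b *: x -> F t3 = a *: u + b *: y ->
  3^-1 *: \sum_(t <- [:: t1; t2; t3]) F t = a *: u + (b / 3) *: (x + y + z).
Proof.
move=> nz3 F1 F2 F3; rewrite !big_cons big_nil addr0 F1 F2 F3 addrC.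
rewrite [a *: u + b *: x + _]addrACA [_ + (a *: u + b *: z)]addrACA.
rewrite -!scalerDl -!scalerDr [LHS]scalerDr !scalerA.
by congr (_ *: _ + _ *: _); field.
Qed.

Section Channels.
Variables (R : realType) (M : nat).
Local Notation C := R[i].
Implicit Types (p : R) (m : 'I_M) (rho : 'M[C]_(qdim M)).

Lemma unitary_conj_dephasing p m rho (U V : 'M[C]_(qdim M)) :
  U^t* *m U = 1%:M -> U^t* *m on_qubit m (pauliZ R) *m U = V ->
  U^t* *m dephasing p m (U *m rho *m U^t*) *m U
  = (1 - p)%:C *: rho + p%:C *: (V *m rho *m V).
Proof. by move=> unitaryU <-; apply: conj_channel. Qed.

Lemma twirled_dephasingE p m rho :
  twirled_dephasing p m rho = depolarizing p m rho.
Proof.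
have adj1 : (1%:M : 'M[C]_(qdim M))^t* = 1%:M by rewrite trmx1 map_mx1.
have twirlI : (1%:M : 'M[C]_(qdim M))^t* *m on_qubit m (pauliZ R) *m 1%:M
              = on_qubit m (pauliZ R).
  by rewrite adj1 mul1mx mulmx1.
have unitaryI : (1%:M : 'M[C]_(qdim M))^t* *m 1%:M = 1%:M.
  by rewrite adj1 mulmx1.
have unitaryH : (on_qubit m (hadamard R))^t* *m on_qubit m (hadamard R) = 1%:M.
  by rewrite on_qubit_adj on_qubitM hadamard_unitary on_qubit1.
have twirlH : (on_qubit m (hadamard R))^t* *m on_qubit m (pauliZ R)
    *m on_qubit m (hadamard R) = on_qubit m (pauliX R).
  by rewrite on_qubit_adj !on_qubitM hadamard_pauliZ.
have adjHS : (hadamard R *m phaseS R)^t* = (phaseS R)^t* *m (hadamard R)^t*.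
  by rewrite trmx_mul map_mxM.
have unitaryHS : (on_qubit m (hadamard R) *m on_qubit m (phaseS R))^t*
    *m (on_qubit m (hadamard R) *m on_qubit m (phaseS R)) = 1%:M.
  rewrite on_qubitM on_qubit_adj on_qubitM adjHS mulmxA.
  rewrite -(mulmxA ((phaseS R)^t*)) hadamard_unitary mulmx1.
  by rewrite phaseS_unitary on_qubit1.
have twirlHS : (on_qubit m (hadamard R) *m on_qubit m (phaseS R))^t*
    *m on_qubit m (pauliZ R)
    *m (on_qubit m (hadamard R) *m on_qubit m (phaseS R))
    = - on_qubit m (pauliY R).
  rewrite on_qubitM on_qubit_adj !on_qubitM adjHS -on_qubitN -phaseS_pauliX.
  by rewrite -hadamard_pauliZ !mulmxA.
have pC3 : (p / 3)%:C = p%:C / 3 :> C by rewrite rmorphM fmorphV rmorph_nat.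
rewrite /depolarizing pC3; apply: average_sum3; first by rewrite pnatr_eq0.
- exact: unitary_conj_dephasing unitaryI twirlI.
- exact: unitary_conj_dephasing unitaryH twirlH.
- rewrite (unitary_conj_dephasing p rho unitaryHS twirlHS).
  by rewrite mulNmx mulmxN mulNmx opprK.
Qed.

Lemma fully_twirledE p rho :
  fully_twirled_dephasing M p rho = local_depolarizing M p rho.
Proof.
rewrite /fully_twirled_dephasing /local_depolarizing /compose_qubits.
elim: (enum 'I_M) rho => //= m s IHs rho.
by rewrite twirled_dephasingE IHs.
Qed.

(** * Depolarization and purification of product states *)

Lemma depolarizing_tens p m (A : 'I_M -> 'M[C]_2) :
  depolarizing p m (tens_op A)
  = tens_op (with_factor m (depolarize1 p (A m)) A).
Proof.
rewrite /depolarizing !on_qubit_sandwich -!tens_op_factorD -tens_op_factorZ.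
rewrite -{1}(eq_tens_op (with_factor_id m A)) -tens_op_factorZ.
by rewrite -tens_op_factorD.
Qed.

Lemma local_depolarizing_tens p (A : 'I_M -> 'M[C]_2) :
  local_depolarizing M p (tens_op A) = tens_op (fun k => depolarize1 p (A k)).
Proof.
rewrite /local_depolarizing /compose_qubits.
(* Generalizes to a duplicate-free list of qubits: exactly its members have been depolarized, each
   once. *)
transitivity (tens_op (fun k => if k \in enum 'I_M
                                then depolarize1 p (A k) else A k)); last first.
  by apply: eq_tens_op => k; rewrite mem_enum.
elim: (enum 'I_M) (enum_uniq 'I_M) A => [|m s IHs] /= => [_ A|].
  exact: eq_tens_op.
move=> /andP[m_s uniq_s] A; rewrite depolarizing_tens IHs //.
apply: eq_tens_op => k; rewrite /with_factor inE.
by case: eqP => [->|_] //=; rewrite (negPf m_s).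
Qed.

(** The trace stays a separate inverse factor, so no condition on p is required; the ratio r / (1 -
    r) appears only once p < 3/4 is assumed. *)
Lemma purified_fidelity p l :
  let r := 2 * p / 3 in let N := (2 ^ l)%N in
  fidelity (plus_state M)
    (purify l (fully_twirled_dephasing M p (plus_state M *m (plus_state M)^t*)))
  = ((((1 - r) ^+ N + r ^+ N) ^+ M)^-1 * ((1 - r) ^+ N) ^+ M)%:C.
Proof.
move=> r N; rewrite fully_twirledE tens_ket_outer local_depolarizing_tens.
have -> : tens_op (fun _ : 'I_M => depolarize1 p (ket_plus R *m (ket_plus R)^t*))
        = tens_op (fun=> plus_minus_diag (1 - r)%:C r%:C).
  apply: eq_tens_op => k; rewrite ket_plus_outer.
  by rewrite depolarize_plus_minus_diag !mulr0 !mulr1 !addr0.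
rewrite /purify tens_opX fidelityZ fidelity_tens mxtrace_tens_op.
under eq_bigr do rewrite plus_minus_diagX mxtrace_plus_minus_diag.
under [X in _ * X]eq_bigr do rewrite plus_minus_diagX ket_plus_expectation.
by rewrite !prodr_const !card_ord !(rmorphM, fmorphV, rmorphXn, rmorphD).
Qed.

Lemma fidelity_plus_state :
  fidelity (plus_state M) (plus_state M *m (plus_state M)^t*) = 1 :> C.
Proof.
rewrite tens_ket_outer fidelity_tens big1 // => k _.
by rewrite ket_plus_outer ket_plus_expectation.
Qed.

(** * Limits of the logical error rate and the threshold *)

(** Real form of [gammaL], so that limits are computed in [R] and transferred to [R[i]]
    afterwards. *)
Definition gamma_plus p l : R :=
  let r := 2 * p / 3 in
  1 - (((1 - r) ^+ (2 ^ l) + r ^+ (2 ^ l)) ^+ M)^-1 * ((1 - r) ^+ (2 ^ l)) ^+ M.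

Lemma gammaL_plus p l :
  gammaL (fully_twirled_dephasing M) (plus_state M) l p = (gamma_plus p l)%:C.
Proof.
rewrite /gammaL /fidelity_after /= fidelity_plus_state purified_fidelity.
by rewrite -(rmorph1 (real_complex R)) -rmorphB.
Qed.

Lemma gamma_plusE p l : p < 3 / 4 ->
  let r := 2 * p / 3 in
  gamma_plus p l = 1 - (1 + (r / (1 - r)) ^+ (2 ^ l)) ^- M.
Proof.
move=> p_lt r; have r1 : 1 - r != 0 by apply: lt0r_neq0; rewrite /r; lra.
have rN : (1 - r) ^+ (2 ^ l) != 0 by rewrite expf_neq0.
rewrite /gamma_plus -/r -exprVn -exprMn -exprVn; congr (1 - _ ^+ M).
have -> : 1 + (r / (1 - r)) ^+ (2 ^ l)
        = ((1 - r) ^+ (2 ^ l) + r ^+ (2 ^ l)) / (1 - r) ^+ (2 ^ l).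
  by rewrite expr_div_n mulrDl divff.
by rewrite invf_div mulrC.
Qed.

Lemma gamma_plus_cvg p : 0 <= p -> p < 3 / 4 ->
  (gamma_plus p l @[l --> \oo] --> (0 : R))%classic.
Proof.
move=> p0 p_lt; pose s := (2 * p / 3) / (1 - 2 * p / 3).
have d0 : 0 < 1 - 2 * p / 3 by lra.
have s0 : 0 <= s by apply: divr_ge0; [lra | exact: ltW].
have s1 : s < 1 by rewrite ltr_pdivrMr // mul1r; lra.
(* Since 0 <= s < 1 and l <= 2^l, the sequence is squeezed between 0 and s^l. *)
have cvg_s : (s ^+ (2 ^ l) @[l --> \oo] --> (0 : R))%classic.
  apply: (@squeeze_cvgr _ _ _ _ (fun=> 0) (GRing.exp s)).
  - near=> l; rewrite exprn_ge0 //= ler_wiXn2l //; first exact: ltW.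
    by rewrite ltnW // ltn_expl.
  - exact: cvg_cst.
  - by apply: cvg_expr; rewrite ger0_norm.
under eq_fun do rewrite gamma_plusE // -/s.
(* The limit is written in the shape of the sequence, with 0 in place of the vanishing power, to
   match the continuity lemmas. *)
have -> : 0 = 1 - (1 + 0) ^- M :> R by rewrite addr0 expr1n invr1 subrr.
apply: cvgB; first exact: cvg_cst.
apply: cvgV; first by rewrite addr0 expr1n oner_eq0.
apply: continuous_cvg (@exprn_continuous R M _) _.
by apply: cvgD cvg_s; exact: cvg_cst.
Unshelve. all: by end_near.
Qed.

(** Here r = 1 - r = 1/2: every qubit is maximally mixed, and purification leaves such a state
    unchanged. *)
Lemma gamma_plus_critical l : gamma_plus (3 / 4) l = 1 - 2^-1 ^+ M.
Proof.
rewrite /gamma_plus.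
have -> : 2 * (3 / 4) / 3 = 2^-1 :> R by field.
have -> : 1 - 2^-1 = 2^-1 :> R by field.
have h : (2^-1 : R) ^+ (2 ^ l) != 0 by rewrite expf_neq0 // invr_eq0 pnatr_eq0.
rewrite -exprVn -exprMn; congr (1 - _ ^+ M).
by move: ((2^-1 : R) ^+ _) h => x nz_x; field; rewrite -mulr2n mulrn_eq0.
Qed.

Lemma real_complex_cvg (f : nat -> R) :
  (f l @[l --> \oo] --> (0 : R))%classic ->
  ((f l)%:C @[l --> \oo] --> (0 : C^o))%classic.
Proof.
move=> /cvgr0Pnorm_lt f0; apply/(@cvgr0Pnorm_lt C C^o) => -[e e'].
(* A positive complex epsilon has zero imaginary part, so it is a positive real bound. *)
rewrite ltcE /= => /andP[/eqP-> /f0]; apply: filterS => l.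
by rewrite normc_def /= expr0n addr0 sqrtr_sqr ltcR.
Qed.

End Channels.

Theorem mainTheorem5 (R : realType) (M : nat) (hM : (1 <= M)%N) :
  (forall p : R, 0 <= p <= 1 ->
     (forall (m : 'I_M) (rho : 'M[R[i]]_(qdim M)),
        twirled_dephasing p m rho = depolarizing p m rho) /\
     (forall rho : 'M[R[i]]_(qdim M),
        fully_twirled_dephasing M p rho = local_depolarizing M p rho)) /\
  is_pqes_threshold (fully_twirled_dephasing (R := R) M) (plus_state M) (3 / 4).
Proof.
split=> [p _|].
  by split=> *; [exact: twirled_dephasingE | exact: fully_twirledE].
split=> [|t [/andP[t0 t1] suppressed]].
  split=> [|p /andP[p0 p1] p_lt]; first by lra.
  under eq_fun do rewrite gammaL_plus.
  exact/real_complex_cvg/gamma_plus_cvg.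
(* If t exceeded 3/4, suppression would hold at p = 3/4 itself, where the error rate is a constant
   sequence. *)
rewrite leNgt; apply/negP => t_gt.
have /suppressed/(_ t_gt) : 0 <= (3 / 4 : R) <= 1 by lra.
under eq_fun do rewrite gammaL_plus gamma_plus_critical.
move=> cvg0.
have /complexI/eqP : (1 - 2^-1 ^+ M)%:C = 0%:C :> R[i].
  exact: (cvg_unique (@norm_hausdorff _ R[i]^o) (cvg_cst _) cvg0).
(* [hM] enters here: 2^-M < 1 requires M >= 1. *)
rewrite subr_eq0 gt_eqF // exprn_ilt1 -?lt0n ?invr_ge0 ?ler0n //.
by rewrite invf_lt1 ?ltr1n ?ltr0n.
Qed.
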